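(* Let $(\mathfrak{g}, [\cdot,\dots,\cdot])$ be an $n$-Lie superalgebra over a field $\mathbb{K}$, let $\mathfrak{h}$ be an ideal of $(\mathfrak{g}, [\cdot,\dots,\cdot])$, and let $S : \mathfrak{g} \to \mathbb{K}$ be a supertrace of $[\cdot,\dots,\cdot]$. Then $\mathfrak{h}$ is an ideal of the induced $(n+1)$-Lie superalgebra $(\mathfrak{g}, [\cdot,\dots,\cdot]_S)$ if and only if $[\mathfrak{g},\mathfrak{g},\dots,\mathfrak{g}] \subseteq \mathfrak{h}$ or $\mathfrak{h} \subseteq \ker S$.
   Context: A super vector space is a direct sum $V = V_{\overline 0} \oplus V_{\overline 1}$; a nonzero element $x$ is homogeneous if $x \in V_{\overline 0}$ (parity $|x| = \overline 0$) or $x \in V_{\overline 1}$ (parity $|x| = \overline 1$). Whenever $|x|$ is written, $x$ is assumed homogeneous; identities involving parities are stated for homogeneous elements and extended by multilinearity. For $\mathrm{x} = (x_1, x_2, \dots)$ write $|\mathrm{x}|_i = \sum_{j=1}^{i} |x_j|$ (so $|\mathrm{x}|_0=\overline 0$). An $n$-Lie superalgebra ($n \ge 2$) is a super vector space $\mathfrak{g}$ over $\mathbb{K}$ with an $n$-linear map $[\cdot,\dots,\cdot] : \mathfrak{g}^n \to \mathfrak{g}$ such that (1) $|[x_1,\dots,x_n]| = \sum_{i=1}^n |x_i|$; (2) $[x_1,\dots,x_i,x_{i+1},\dots,x_n] = -(-1)^{|x_i||x_{i+1}|}[x_1,\dots,x_{i+1},x_i,\dots,x_n]$; (3) (graded Filippov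 identity) $[y_1,\dots,y_{n-1},[x_1,\dots,x_n]] = \sum_{i=1}^n (-1)^{|\mathrm{x}|_{i-1}|\mathrm{y}|_{n-1}} [x_1,\dots,x_{i-1},[y_1,\dots,y_{n-1},x_i],x_{i+1},\dots,x_n]$. A supertrace of $[\cdot,\dots,\cdot]$ is a linear map $S:\mathfrak{g}\to\mathbb{K}$ with $S([x_1,\dots,x_n]) = 0$ for all $x_1,\dots,x_n\in\mathfrak{g}$ and $S(x)=0$ for all $x \in \mathfrak{g}_{\overline 1}$. The induced bracket $[\cdot,\dots,\cdot]_S:\mathfrak{g}^{n+1}\to\mathfrak{g}$ is $$[x_1,\dots,x_{n+1}]_S = \sum_{i=1}^{n+1} (-1)^{i-1}(-1)^{|x_i||\mathrm{x}|_{i-1}} S(x_i)[x_1,\dots,x_{i-1},x_{i+1},\dots,x_{n+1}],$$ and $(\mathfrak{g},[\cdot,\dots,\cdot]_S)$ is known to be an $(n+1)$-Lie superalgebra, called the induced $(n+1)$-Lie superalgebra. A subspace $\mathfrak{h}$ of a $k$-Lie superalgebra $\mathfrak{g}$ is an ideal if $[h,x_1,\dots,x_{k-1}]\in\mathfrak{h}$ for all $h\in\mathfrak{h}$ and $x_1,\dots,x_{k-1}\in\mathfrak{g}$. The bracket of subspaces denotes the span of all brackets of their elements. *)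

(* Defs.v *)
(* MathComp, with the [set T] of mathcomp-classical for subspaces. *)
From mathcomp Require Import all_boot all_order all_algebra all_fingroup.
From mathcomp Require Import boolp classical_sets.
Set Implicit Arguments.
Unset Strict Implicit.
Unset Printing Implicit Defensive.
Import GRing.Theory.
Local Open Scope classical_set_scope.
Local Open Scope ring_scope.

Record superspace (K : fieldType) := Superspace {
  even_part : lmodType K;
  odd_part : lmodType K }.

Definition super_sum (K : fieldType) (g : superspace K) : lmodType K :=
  (even_part g * odd_part g)%type.
Coercion super_sum : superspace >-> GRing.Lmodule.type.

(* Parities are booleans: [false] is even, [true] is odd, addition in Z/2 is
   [addb] and multiplication is [&&]. *)
Definition homog (K : fieldType) (g : superspace K) (a : bool) : set g :=
  [set x | if a then x.1 = 0 else x.2 = 0].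

(* 0 is homogeneous of both parities; graded identities are required for
   either choice, which is harmless since both sides vanish when an
   argument is 0. *)
Definition homogs (K : fieldType) (g : superspace K) (n : nat)
    (p : n.-tuple bool) (x : n.-tuple g) : Prop :=
  forall i, homog (tnth p i) (tnth x i).

Definition hcomp (K : fieldType) (g : superspace K) (a : bool) (x : g) : g :=
  if a then (0, x.2) else (x.1, 0).

(* |x|_i, the sum of the first i parities *)
Definition psum (n : nat) (p : n.-tuple bool) (i : nat) : bool :=
  \big[addb/false]_(a <- take i p) a.

Section Tuples.
Variables (T : Type) (n : nat).
Implicit Types x : n.-tuple T.

Definition tset x (i : 'I_n) (u : T) : n.-tuple T :=
  [tuple if j == i then u else tnth x j | j < n].

Definition tswap x (i j : 'I_n) : n.-tuple T :=
  [tuple tnth x (tperm i j k) | k < n].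

Definition tdel (x : n.+1.-tuple T) (i : 'I_n.+1) : n.-tuple T :=
  [tuple tnth x (lift i j) | j < n].
End Tuples.

Definition multilinear (K : fieldType) (V W : lmodType K) (n : nat)
    (f : n.-tuple V -> W) : Prop :=
  forall (x : n.-tuple V) (i : 'I_n) (a : K) (u v : V),
    f (tset x i (a *: u + v)) = a *: f (tset x i u) + f (tset x i v).

(* [br] is the bracket of an (n+1)-Lie superalgebra. Indices start at 0, so
   that the sign exponent |x|_{i-1} of the i-th argument is [psum p i]. *)
Record is_nlie_super (K : fieldType) (g : superspace K) (n : nat)
    (br : n.+1.-tuple g -> g) : Prop := IsNLieSuper {
  nlie_multilinear : multilinear br;
  nlie_parity : forall (p : n.+1.-tuple bool) (x : n.+1.-tuple g),
    homogs p x -> homog (psum p n.+1) (br x);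
  nlie_skew : forall (p : n.+1.-tuple bool) (x : n.+1.-tuple g)
      (i j : 'I_n.+1), j = i.+1 :> nat -> homogs p x ->
    br x = - ((-1) ^+ (tnth p i && tnth p j) *: br (tswap x i j));
  nlie_filippov : forall (q : n.-tuple bool) (p : n.+1.-tuple bool)
      (y : n.-tuple g) (x : n.+1.-tuple g), homogs q y -> homogs p x ->
    br [tuple of rcons y (br x)] =
      \sum_(i < n.+1) (-1) ^+ (psum p i && psum q n) *:
        br (tset x i (br [tuple of rcons y (tnth x i)])) }.

Definition is_supertrace (K : fieldType) (g : superspace K) (n : nat)
    (br : n.-tuple g -> g) (S : {scalar g}) : Prop :=
  (forall x, S (br x) = 0) /\ (forall x, homog true x -> S x = 0).

(* The formula for the induced bracket on homogeneous arguments x of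
   parities p *)
Definition induced_homog (K : fieldType) (g : superspace K) (n : nat)
    (br : n.-tuple g -> g) (S : {scalar g})
    (p : n.+1.-tuple bool) (x : n.+1.-tuple g) : g :=
  \sum_(i < n.+1) ((-1) ^+ i * (-1) ^+ (tnth p i && psum p i) * S (tnth x i))
    *: br (tdel x i).

(* Its multilinear extension: every argument is split into its even and odd
   components; see [induced_homogE] and [induced_multilinear] below. *)
Definition induced (K : fieldType) (g : superspace K) (n : nat)
    (br : n.-tuple g -> g) (S : {scalar g}) (x : n.+1.-tuple g) : g :=
  \sum_(p : n.+1.-tuple bool)
    induced_homog br S p [tuple hcomp (tnth p i) (tnth x i) | i < n.+1].

Definition is_subspace (K : fieldType) (V : lmodType K) (h : set V) : Prop :=
  h 0 /\ forall (a : K) (u v : V), h u -> h v -> h (a *: u + v).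

Definition span (K : fieldType) (V : lmodType K) (A : set V) : set V :=
  smallest (@is_subspace K V) A.

Definition bracket_span (K : fieldType) (V : lmodType K) (n : nat)
    (br : n.-tuple V -> V) (A : 'I_n -> set V) : set V :=
  span [set br x | x in [set x | forall i, A i (tnth x i)]].

(* Subspaces, hence ideals, are not required to be graded. *)
Definition is_ideal (K : fieldType) (V : lmodType K) (n : nat)
    (br : n.+1.-tuple V -> V) (h : set V) : Prop :=
  is_subspace h /\
  forall (u : V) (x : n.-tuple V), h u -> h (br [tuple of u :: x]).

Lemma multilinear0 (K : fieldType) (V W : lmodType K) (n : nat)
    (f : n.-tuple V -> W) (x : n.-tuple V) (i : 'I_n) :
  multilinear f -> tnth x i = 0 -> f x = 0.
Proof.
move=> fM xi0.
have E : tset x i 0 = x.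
  by apply: eq_from_tnth => j; rewrite tnth_mktuple; case: eqP => [->|].
have := fM x i (-1) 0 0.
by rewrite scaler0 addr0 E scaleN1r addNr.
Qed.

Lemma induced_homogE (K : fieldType) (g : superspace K) (n : nat)
    (br : n.-tuple g -> g) (S : {scalar g})
    (p : n.+1.-tuple bool) (x : n.+1.-tuple g) :
  multilinear br -> homogs p x -> induced br S x = induced_homog br S p x.
Proof.
move=> brM hx; rewrite /induced (bigD1 p) //= [X in _ + X]big1 ?addr0.
  congr induced_homog; apply: eq_from_tnth => i; rewrite tnth_mktuple.
  move: (hx i); rewrite /homog /hcomp /=.
  by case: (tnth p i) (tnth x i) => -[u v] /= ->.
move=> q qp; have [j qj] : exists j, tnth q j != tnth p j.
  apply/existsP; apply: contraR qp; rewrite negb_exists => /forallP qp.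
  by apply/eqP/eq_from_tnth => j; apply/eqP; rewrite -[_ == _]negbK.
set y := [tuple _ | i < _].
have yj : tnth y j = 0.
  rewrite tnth_mktuple; move: (hx j) qj; rewrite /homog /hcomp /=.
  by case: (tnth p j) (tnth q j) (tnth x j) => -[] [u v] //= ->.
apply: big1 => i _; have [->|] := eqVneq i j.
  by rewrite yj linear0 mulr0 scale0r.
move=> /unlift_some[k jk _].
by rewrite (@multilinear0 _ _ _ _ _ _ k brM) ?scaler0 // tnth_mktuple -jk.
Qed.

Lemma induced_multilinear (K : fieldType) (g : superspace K) (n : nat)
    (br : n.-tuple g -> g) (S : {scalar g}) :
  multilinear br -> multilinear (induced br S).
Proof.
move=> brM x i a u v; rewrite /induced scaler_sumr -big_split /=.
apply: eq_bigr => p _; rewrite /induced_homog scaler_sumr -big_split /=.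
apply: eq_bigr => j _; set y := [tuple hcomp (tnth p k) (tnth x k) | k < n.+1].
have E w : [tuple hcomp (tnth p k) (tnth (tset x i w) k) | k < n.+1]
         = tset y i (hcomp (tnth p i) w).
  apply: eq_from_tnth => k; rewrite !tnth_mktuple.
  by case: eqP => [->|].
have hD : hcomp (tnth p i) (a *: u + v)
        = a *: hcomp (tnth p i) u + hcomp (tnth p i) v.
  case: u v => [u1 u2] [v1 v2]; rewrite /hcomp; case: (tnth p i);
    by congr pair; rewrite /= ?scaler0 ?addr0.
rewrite !E hD; set w := hcomp _ u; set w' := hcomp _ v.
have [->|ji] := eqVneq j i.
  have D t : tdel (tset y i t) i = tdel y i.
    apply: eq_from_tnth => k; rewrite !tnth_mktuple.
    by rewrite eq_sym (negbTE (neq_lift _ _)).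
  by rewrite !D !tnth_mktuple eqxx linearP mulrDr scalerDl scalerA mulrCA.
have /unlift_some[k ik _] := ji.
have D t : tdel (tset y i t) j = tset (tdel y j) k t.
  apply: eq_from_tnth => l; rewrite !tnth_mktuple ik.
  by rewrite (inj_eq lift_inj).
rewrite !D brM !tnth_mktuple (negbTE ji) scalerDr !scalerA; congr (_ *: _ + _).
by rewrite mulrC.
Qed.

(* Main.v *)
Require Import Defs.
From mathcomp Require Import all_boot all_order all_algebra all_fingroup.
From mathcomp Require Import boolp classical_sets.
Set Implicit Arguments.
Unset Strict Implicit.
Unset Printing Implicit Defensive.
Import GRing.Theory.
Local Open Scope classical_set_scope.
Local Open Scope ring_scope.

(** A supertrace [S] vanishes on odd elements, so in the induced bracket a
    summand with [S (x_i) <> 0] has [|x_i|] even and its parity sign is trivial.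
    Hence, for arbitrary arguments, homogeneous or not, the induced bracket is
    the alternating sum of the [S (x_i) *: br (x with x_i removed)]
    ([induced_supertraceE]). When the first argument [u] lies in an ideal [h],
    every summand except the one at [u] still contains [u], so lies in [h];
    modulo [h] the induced bracket of [u :: x] is therefore [S u *: br x]
    ([induced_cons_mod_ideal]). So [h] is an ideal of the induced bracket
    exactly when [S u *: br x] lies in [h] for all [u] in [h] and all [x], and,
    [K] being a field, this means that [S] kills [h] or that [h] contains all
    brackets. *)

Lemma hcompD (K : fieldType) (g : superspace K) (x : g) :
  x = hcomp false x + hcomp true x.
Proof. by case: x => u v; congr pair; rewrite /= ?addr0 ?add0r. Qed.

(** Splitting the arguments one by one into even and odd components reduces the
    equality of two multilinear maps to homogeneous arguments. *)
Lemma multilinear_homog_ext (K : fieldType) (g : superspace K)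
    (W : lmodType K) (n : nat) (f1 f2 : n.-tuple g -> W) :
  multilinear f1 -> multilinear f2 ->
  (forall p x, homogs p x -> f1 x = f2 x) -> f1 =1 f2.
Proof.
move=> f1M f2M f12.
(* Only the first [k] arguments may fail to be homogeneous. *)
suff ext k : forall x : n.-tuple g,
    (forall i : 'I_n, (k <= i)%N -> exists a, homog a (tnth x i)) ->
    f1 x = f2 x.
  by move=> x; apply: (ext n) => i; rewrite leqNgt ltn_ord.
elim: k => [|k IHk] x hx.
  (* This choice of parities declares a zero argument odd. *)
  apply: (f12 [tuple (tnth x i).1 == 0 | i < n]) => i.
  rewrite tnth_mktuple /homog /=; case: eqP => // x1.
  by have [[] //] := hx i isT.
have [kn|nk] := ltnP k n; last first.
  by apply: IHk => i ki; move: (leq_trans nk ki); rewrite leqNgt ltn_ord.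
pose j := Ordinal kn.
have Ex : x = tset x j (1 *: hcomp false (tnth x j) + hcomp true (tnth x j)).
  rewrite scale1r -hcompD; apply: eq_from_tnth => i.
  by rewrite tnth_mktuple; case: eqP => [->|].
have fE a : f1 (tset x j (hcomp a (tnth x j)))
          = f2 (tset x j (hcomp a (tnth x j))).
  apply: IHk => i ki; rewrite tnth_mktuple.
  case: eqP => [_|/eqP ij]; first by exists a; rewrite /homog /hcomp; case: a.
  by apply: hx; rewrite ltn_neqAle ki andbT eq_sym.
by rewrite Ex f1M f2M !fE.
Qed.

Definition trace_bracket (K : fieldType) (V : lmodType K) (n : nat)
    (br : n.-tuple V -> V) (S : {scalar V}) (x : n.+1.-tuple V) : V :=
  \sum_(i < n.+1) ((-1) ^+ i * S (tnth x i)) *: br (tdel x i).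

Lemma trace_bracket_multilinear (K : fieldType) (V : lmodType K) (n : nat)
    (br : n.-tuple V -> V) (S : {scalar V}) :
  multilinear br -> multilinear (trace_bracket br S).
Proof.
move=> brM x i a u v; rewrite /trace_bracket scaler_sumr -big_split /=.
apply: eq_bigr => j _.
have [->|/[dup] ji /unlift_some[k ik _]] := eqVneq j i.
  have D t : tdel (tset x i t) i = tdel x i.
    apply: eq_from_tnth => k; rewrite !tnth_mktuple.
    by rewrite eq_sym (negbTE (neq_lift _ _)).
  by rewrite !D !tnth_mktuple eqxx linearP mulrDr scalerDl scalerA mulrCA.
have D t : tdel (tset x i t) j = tset (tdel x j) k t.
  by apply: eq_from_tnth => l; rewrite !tnth_mktuple ik (inj_eq lift_inj).
rewrite !D brM !tnth_mktuple (negbTE ji) scalerDr !scalerA.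
by congr (_ *: _ + _); rewrite mulrC.
Qed.

(** The sign [(-1) ^+ (|x_i| |x|_{i-1})] differs from 1 only when [x_i] is odd,
    and then [S x_i = 0]. *)
Lemma induced_supertraceE (K : fieldType) (g : superspace K) (n : nat)
    (br : n.-tuple g -> g) (S : {scalar g}) :
  multilinear br -> is_supertrace br S ->
  induced br S =1 trace_bracket br S.
Proof.
move=> brM [_ Sodd]; apply: multilinear_homog_ext.
- exact: induced_multilinear.
- exact: trace_bracket_multilinear.
move=> p x hx; rewrite (induced_homogE _ brM hx); apply: eq_bigr => i _.
move: (hx i); case: (tnth p i) => [/Sodd ->|_]; first by rewrite !mulr0.
by rewrite mulr1.
Qed.

Lemma subspace_sum (K : fieldType) (V : lmodType K) (h : set V) (I : finType)
    (c : I -> K) (F : I -> V) :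
  is_subspace h -> (forall i, h (F i)) -> h (\sum_i c i *: F i).
Proof.
move=> [h0 hD] hF; elim/big_rec: _ => // i v _ hv; exact: hD.
Qed.

(** Deleting any entry of [u :: x] other than the first leaves [u] in front, so
    the corresponding summands of the induced bracket lie in the ideal. *)
Lemma induced_cons_mod_ideal (K : fieldType) (g : superspace K) (n : nat)
    (br : n.+1.-tuple g -> g) (S : {scalar g}) (h : set g)
    (u : g) (x : n.+1.-tuple g) :
  multilinear br -> is_supertrace br S -> is_ideal br h -> h u ->
  exists2 w, h w & induced br S [tuple of u :: x] = S u *: br x + w.
Proof.
move=> brM Str [hV hI] hu.
exists (\sum_(i < n.+1) ((-1) ^+ i.+1 * S (tnth x i)) *:
          br [tuple of u :: tdel x i]).
  by apply: subspace_sum => // i; apply: hI.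
rewrite induced_supertraceE // /trace_bracket big_ord_recl mul1r.
congr (_ *: br _ + _).
  by apply: eq_from_tnth => i; rewrite tnth_mktuple tnthS.
apply: eq_bigr => i _; rewrite tnthS; congr (_ *: br _).
apply: eq_from_tnth => j; rewrite tnth_mktuple.
case: (unliftP ord0 j) => [k ->|->]; last first.
  by rewrite [lift _ _](_ : _ = ord0) //; apply: val_inj.
have -> : lift (lift ord0 i) (lift ord0 k) = lift ord0 (lift i k).
  by apply: val_inj; rewrite /= /bump /= !add1n ltnS addnS.
by rewrite !tnthS tnth_mktuple.
Qed.

Theorem proposition2 (K : fieldType) (n : nat) (n_ge2 : (2 <= n.+1)%N)
    (g : superspace K) (br : n.+1.-tuple g -> g) (h : set g) (S : {scalar g}) :
  is_nlie_super br -> is_ideal br h -> is_supertrace br S ->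
  (is_ideal (induced br S) h <->
     (bracket_span br (fun=> setT) `<=` h \/ h `<=` [set x | S x = 0])).
Proof.
move=> /nlie_multilinear brM hI Str; have [hV _] := hI; have [h0 hD] := hV.
have hZ a v : h v -> h (a *: v) by move=> hv; rewrite -[_ *: _]addr0; apply: hD.
split=> [[_ indI]|brS].
  have [hS|/existsNP[u /not_implyP[hu Su]]] := EM (h `<=` [set x | S x = 0]).
    by right.
  left; apply: smallest_sub => // _ [x _ <-].
  have [w hw E] := induced_cons_mod_ideal x brM Str hI hu.
  have -> : br x = (S u)^-1 *: (-1 *: w + induced br S [tuple of u :: x]).
    rewrite E scaleN1r addrC addrK scalerA mulVf ?scale1r //; exact/eqP.
  by apply/hZ/hD => //; apply: indI.
split=> // u x hu.
have [w hw ->] := induced_cons_mod_ideal x brM Str hI hu.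
case: brS => [brh|/(_ u hu) /= ->]; last by rewrite scale0r add0r.
by apply: hD => //; apply: brh; apply: sub_gen_smallest; exists x.
Qed.
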